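(* Set $\Delta:=x_1v_2-x_2v_1$. The projective billiards of the types listed in the context have the following 0-homogeneous rational integrals. Case 1): a ratio of two homogeneous quadratic polynomials in $(v_1,v_2,\Delta)$. Case 2a1), $\rho=2-\frac{2}{2N+1}$: $$\Psi_{2a1}=\frac{(4v_1\Delta-v_2^2)^{2N+1}}{v_1^2\prod_{j=1}^N(4v_1\Delta-c_jv_2^2)^2},\qquad c_j=-\frac{4j(2N+1-j)}{(2N+1-2j)^2}.$$ Case 2a2), $\rho=2-\frac1{N+1}$: $$\Psi_{2a2}=\frac{(4v_1\Delta-v_2^2)^{N+1}}{v_1v_2\prod_{j=1}^N(4v_1\Delta-c_jv_2^2)},\qquad c_j=-\frac{j(2N+2-j)}{(N+1-j)^2}.$$ Case 2b1): $$\Psi_{2b1}=\frac{(4v_1\Delta-v_2^2)^2}{(4v_1\Delta+3v_2^2)(2v_1+v_2)(2\Delta+v_2)}.$$ Case 2b2): $$\Psi_{2b2}=\frac{(4v_1\Delta-v_2^2)^2}{(v_2^2+4\Delta^2+4v_1\Delta+4v_1^2)(v_2^2+4v_1^2)}.$$ Case 2c1): $$\Psi_{2c1}=\frac{(4v_1\Delta-v_2^2)^3}{(v_1^3+\Delta^3+v_1v_2\Delta)^2}.$$ Case 2c2): $$\Psi_{2c2}=\frac{(4v_1\Delta-v_2^2)^3}{(v_2^3+2v_2^2v_1+(v_1^2+2v_2^2+5v_1v_2)\Delta+v_1\Delta^2)^2}.$$ Case 2d): $$\Psi_{2d}=\frac{(4v_1\Delta-v_2^2)^3}{(v_1\Del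ta+2v_2^2)(2v_1+v_2)(8v_1v_2^2+2v_2^3+(4v_1^2+5v_2^2+28v_1v_2)\Delta+16v_1\Delta^2)}.$$
   Context: $\mathbb N=\{1,2,\dots\}$. A projective billiard is a smooth planar curve $C\subset\mathbb R^2_{x_1,x_2}$ with a transversal line field $\mathcal N$. The reflection at $Q\in C$ is the affine involution that fixes the points of the tangent line to $C$ at $Q$, preserves $\mathcal N(Q)$ and acts on $\mathcal N(Q)$ as the central symmetry with respect to $Q$. The projective billiard flow moves $(x,v)$, $x=(x_1,x_2)$, $v=(v_1,v_2)\in T_x\mathbb R^2$, with constant velocity $v$ until it hits $C$, where $v$ is replaced by its reflection image. A 0-homogeneous rational integral is a non-constant first integral of the flow that is, for each $x$, a ratio of two homogeneous polynomials in $v$ of the same (uniformly bounded) degree. The projective billiards considered: Case 1): space form billiards on a (punctured) conic $C$ with matrix $A=\mathrm{diag}(1,1,-1)$: in homogeneous coordinates $[x_1:x_2:x_3]$, for every $Q$ the two-dimensional subspaces of $\mathbb R^3$ projected to the tangent line $T_QC$ and to $\mathcal N(Q)$ are orthogonal with respect to the scalar product $\langle Ax,x\rangle$. Cases 2): $C=\{x_2=x_1^2\}$ (punctured in finitely many points), with $\mathcal N$ directed at points of $C$ by the vector field $(\dot x_1,\dot x_2)$ equal to: 2a) $(\rho,2(\rho-2)x_1)$ with $\rho=2-\frac{2}{2N+1}$ (2a1)) or $\rho=2-\frac{1}{N+1}$ (2a2)), $N\in\mathbb N$; 2b1) $(5x_1+3,2(x_2-x_1))$; 2b2) $(3x_1,2x_2-4)$;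 2c1) $(x_2,x_1x_2-1)$; 2c2) $(2x_1+1,x_2-x_1)$; 2d) $(7x_1+4,2x_2-4x_1)$. *)

(* Defs.v *)
From HB Require Import structures.
From mathcomp Require Import all_boot all_order all_algebra.
From mathcomp Require Import all_classical all_reals all_analysis.

Set Implicit Arguments.
Unset Strict Implicit.
Unset Printing Implicit Defensive.

Import Order.TTheory GRing.Theory Num.Theory.
Import numFieldNormedType.Exports.

Local Open Scope classical_set_scope.
Local Open Scope ring_scope.

Section Coordinates.
Variable R : realType.

Definition vec2 (a b : R) : 'rV[R]_2 := \row_(i < 2) [:: a; b]`_i.
Definition vec3 (a b c : R) : 'rV[R]_3 := \row_(i < 3) [:: a; b; c]`_i.

Definition crd1 (x : 'rV[R]_2) : R := x 0 0.
Definition crd2 (x : 'rV[R]_2) : R := x 0 1.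

Definition Delta (x v : 'rV[R]_2) : R := crd1 x * crd2 v - crd2 x * crd1 v.

(* The quadratic form u |-> u S u^T. *)
Definition qform (S : 'M[R]_3) (u : 'rV[R]_3) : R := (u *m S *m u^T) 0 0.

End Coordinates.

Section ProjectiveBilliard.
Variable R : realType.
Implicit Types (C : set 'rV[R]_2) (N : 'rV[R]_2 -> 'rV[R]_2).

(* For a smooth curve C these vectors, translated by Q, form the tangent line
   to C at Q; the zero vector is included. *)
Definition tangent_vector C (Q w : 'rV[R]_2) : Prop :=
  exists g : R -> 'rV[R]_2,
    [/\ \forall t \near (0 : R), C (g t), g 0 = Q & is_derive (0 : R) 1 g w].

(* A line field on C is given by a field N of directing vectors: its line at
   Q is { Q + k N(Q) : k in R }.  The values of N outside C are irrelevant.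
   Since 0 is a tangent vector, transversality forces N Q != 0 on C. *)
Definition transversal_field C N : Prop :=
  forall Q, C Q -> ~ tangent_vector C Q (N Q).

(* The affine map x |-> x M + b is the reflection at Q. *)
Definition billiard_reflection C N (Q : 'rV[R]_2) (M : 'M[R]_2)
    (b : 'rV[R]_2) : Prop :=
  let s := fun x : 'rV[R]_2 => x *m M + b in
  [/\ involutive s,
      forall w, tangent_vector C Q w -> s (Q + w) = Q + w
    & forall k : R, s (Q + k *: N Q) = Q - k *: N Q].

(* [billiard_flow C N p q]: the trajectory starting at the phase point
   p = (x, v) passes through q.  The velocity, being a vector, is transformed
   by the linear part M of the affine reflection. *)
Inductive billiard_flow C N (p : 'rV[R]_2 * 'rV[R]_2) :
    'rV[R]_2 * 'rV[R]_2 -> Prop :=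
| flow_start : billiard_flow C N p p
| flow_free (x v : 'rV[R]_2) (t : R) :
    billiard_flow C N p (x, v) -> 0 <= t ->
    (forall s, 0 < s <= t -> ~ C (x + s *: v)) ->
    billiard_flow C N p (x + t *: v, v)
| flow_hit (x v : 'rV[R]_2) (t : R) (M : 'M[R]_2) (b : 'rV[R]_2) :
    billiard_flow C N p (x, v) -> 0 < t ->
    (forall s, 0 < s < t -> ~ C (x + s *: v)) ->
    C (x + t *: v) ->
    billiard_reflection C N (x + t *: v) M b ->
    billiard_flow C N p (x + t *: v, v *m M).

(* A ratio num / den is a function with values in the projective line, not
   defined where num = den = 0.  [same_ratio] compares the pairs (num, den)
   up to a common nonzero factor: the two ratios are equal in the projective
   line, or are both undefined. *)
Definition same_ratio (y z : R * R) : Prop :=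
  exists k : R, [/\ k != 0, z.1 = k * y.1 & z.2 = k * y.2].

Implicit Types num den : 'rV[R]_2 -> 'rV[R]_2 -> R.

Definition first_integral C N num den : Prop :=
  forall x v x' v', billiard_flow C N (x, v) (x', v') ->
    same_ratio (num x v, den x v) (num x' v', den x' v').

Definition nonconstant num den : Prop :=
  exists x v x' v', [/\ den x v != 0, den x' v' != 0
    & num x v / den x v != num x' v' / den x' v'].

Definition homogeneous_poly (d : nat) (f : 'rV[R]_2 -> R) : Prop :=
  exists a : nat -> R, forall v,
    f v = \sum_(i < d.+1) a i * crd1 v ^+ i * crd2 v ^+ (d - i).

(* The last two clauses: at no x do both polynomials vanish identically in v,
   and for generic x the denominator does not; at an exceptional x the ratio
   may be the constant function infinity (e.g. if 2 Delta + v2 divides the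
   denominator, at x = (-1/2, 0)). *)
Definition ratio_homogeneous num den : Prop :=
  [/\ exists d, forall x,
        homogeneous_poly d (num x) /\ homogeneous_poly d (den x),
      forall x, exists v, num x v != 0 \/ den x v != 0
    & dense [set x | exists v, den x v != 0]].

Definition rational_0homogeneous_integral C N num den : Prop :=
  [/\ ratio_homogeneous num den, nonconstant num den
    & first_integral C N num den].

(* The function (x, v) |-> P (v1, v2, Delta). *)
Definition in_moments (P : R -> R -> R -> R) (x v : 'rV[R]_2) : R :=
  P (crd1 v) (crd2 v) (Delta x v).

End ProjectiveBilliard.

Section Curves.
Variable R : realType.

(* Affine part x3 = 1 of the conic with matrix B, with the points of F
   removed. *)
Definition punctured_conic (B : 'M[R]_3) (F : set 'rV[R]_2) : set 'rV[R]_2 :=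
  [set x | qform B (vec3 (crd1 x) (crd2 x) 1) = 0] `\` F.

Definition punctured_parabola (F : set 'rV[R]_2) : set 'rV[R]_2 :=
  [set x | crd2 x = crd1 x ^+ 2] `\` F.

Definition matA : 'M[R]_3 := diag_mx (vec3 1 1 (-1)).

(* Two-dimensional subspace of R^3 (as a row space) projected by
   [x1 : x2 : x3] to the line through Q directed by w != 0. *)
Definition plane_over (Q w : 'rV[R]_2) : 'M[R]_(1 + 1, 3) :=
  col_mx (vec3 (crd1 Q) (crd2 Q) 1) (vec3 (crd1 w) (crd2 w) 0).

(* Planes P and P' are perpendicular for the symmetric bilinear form A:
   P' contains the A-orthogonal complement of P (a symmetric relation). *)
Definition orthogonal_planes (A : 'M[R]_3) (P P' : 'M[R]_(1 + 1, 3)) : Prop :=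
  (kermx (A *m P^T) <= P')%MS.

Definition space_form_field (A : 'M[R]_3) (C : set 'rV[R]_2)
    (N : 'rV[R]_2 -> 'rV[R]_2) : Prop :=
  forall Q w, C Q -> tangent_vector C Q w -> w != 0 ->
    orthogonal_planes A (plane_over Q w) (plane_over Q (N Q)).

End Curves.

(* Main.v *)
Require Import Defs.
From HB Require Import structures.
From mathcomp Require Import all_boot all_order all_algebra.
From mathcomp Require Import all_classical all_reals all_analysis.
From mathcomp Require Import ring lra zify.
Import Order.TTheory GRing.Theory Num.Theory.
Import numFieldNormedType.Exports.
Local Open Scope classical_set_scope.
Local Open Scope ring_scope.

(** The moments (v1, v2, Delta) are the coordinates of the line through x
    directed by v, hence constant along free motion; it suffices to compare
    the values at both sides of a reflection.  At Q the incoming velocity is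
    a w + b N with w tangent, and the outgoing one is a w - b N, so a form in
    the moments is invariant as soon as it is even in b.
    In case 1 the forms are the duals of B and of A: their cross terms in a b
    vanish, respectively because the tangent line at Q is polar to Q and
    because of the orthogonality that defines the space form billiard.  In cases
    2 the numerator restricts to a power of a constant times b^2; in 2a the
    factors of the denominator split on the parabola into linear forms in
    (a, b) that recombine into pairs exchanged by b -> -b. *)

(** * Coordinates of plane vectors *)

Lemma crd1_vec2 {R : realType} (a b : R) : crd1 (vec2 a b) = a.
Proof. by rewrite /crd1 mxE. Qed.

Lemma crd2_vec2 {R : realType} (a b : R) : crd2 (vec2 a b) = b.
Proof. by rewrite /crd2 mxE. Qed.

Lemma crd1D {R : realType} (x y : 'rV[R]_2) : crd1 (x + y) = crd1 x + crd1 y.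
Proof. by rewrite /crd1 mxE. Qed.

Lemma crd2D {R : realType} (x y : 'rV[R]_2) : crd2 (x + y) = crd2 x + crd2 y.
Proof. by rewrite /crd2 mxE. Qed.

Lemma crd1Z {R : realType} (k : R) (x : 'rV[R]_2) : crd1 (k *: x) = k * crd1 x.
Proof. by rewrite /crd1 mxE. Qed.

Lemma crd2Z {R : realType} (k : R) (x : 'rV[R]_2) : crd2 (k *: x) = k * crd2 x.
Proof. by rewrite /crd2 mxE. Qed.

Lemma crd1N {R : realType} (x : 'rV[R]_2) : crd1 (- x) = - crd1 x.
Proof. by rewrite /crd1 mxE. Qed.

Lemma crd2N {R : realType} (x : 'rV[R]_2) : crd2 (- x) = - crd2 x.
Proof. by rewrite /crd2 mxE. Qed.

Definition crdE {R : realType} :=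
  (@crd1_vec2 R, @crd2_vec2 R, @crd1D R, @crd2D R, @crd1Z R, @crd2Z R,
   @crd1N R, @crd2N R).

Lemma crd_inj {R : realType} (x y : 'rV[R]_2) :
  crd1 x = crd1 y -> crd2 x = crd2 y -> x = y.
Proof.
rewrite /crd1 /crd2 => h1 h2; apply/rowP => i.
by case: i => [[|[|//]] lti]; [move: h1 | move: h2];
  congr (_ = _); congr (_ _ _); apply: val_inj.
Qed.

(** * Tangent vectors, reflections and transversality *)

Lemma tangent_vectorZ {R : realType} (C : set 'rV[R]_2) (Q w : 'rV[R]_2)
    (k : R) :
  tangent_vector C Q w -> tangent_vector C Q (k *: w).
Proof.
(* Reparametrization by [t |-> k t], valid for [k = 0] as well. *)
case=> g [Cg g0 dg]; exists (g \o ( *%R k)); split.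
- have : ( *%R k) x @[x --> (0 : R)] --> k * 0.
    by apply: cvgM; [exact: cvg_cst | exact: cvg_id].
  rewrite mulr0 => /(_ _ Cg); exact.
- by rewrite /= mulr0.
- have dk : is_derive (0 : R) 1 ( *%R k : R -> R) k.
    have := @is_deriveZ R R R id k 0 1 1 (is_derive_id _ _).
    by rewrite /= [k *: 1]mulr1.
  have dfg : differentiable g (k * 0).
    by rewrite mulr0; apply/derivable1_diffP; case: dg.
  have dfk : differentiable ( *%R k : R -> R) (0 : R).
    by apply/derivable1_diffP; case: dk.
  apply: DeriveDef.
    by apply/derivable1_diffP; apply: differentiable_comp.
  rewrite deriveE; last exact: differentiable_comp.
  rewrite diff_comp //= -(deriveE _ dfk) derive_val mulr0.
  have dfg0 : differentiable g 0 by apply/derivable1_diffP; case: dg.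
  rewrite -[k in LHS]mulr1 -[k * 1]/(k *: (1 : R)) linearZ /=.
  by rewrite -(deriveE _ dfg0) derive_val.
Qed.

(** Gives the velocity of the test curves below: [h] is [t ^+ 2] on the parabola and [t * s t] on
    the conic, so that [z] contributes nothing at [0]. *)
Lemma is_derive_moving_combination {R : realType} (Q w z : 'rV[R]_2)
    (f h : R -> R) (a b : R) :
  is_derive (0 : R) 1 f a -> is_derive (0 : R) 1 h b ->
  is_derive (0 : R) 1 (fun t => Q + f t *: w + h t *: z) (a *: w + b *: z).
Proof.
move=> df dh.
have dZ (k : R -> R) (c : R) (u : 'rV[R]_2) : is_derive (0 : R) 1 k c ->
    is_derive (0 : R) 1 (fun t => k t *: u) (c *: u).
  move=> dk; have kd : differentiable k (0 : R).
    by apply/derivable1_diffP; case: dk.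
  have kZ : differentiable (fun t => k t *: u) (0 : R).
    exact: differentiableZl.
  apply: DeriveDef; first exact/derivable1_diffP.
  by rewrite deriveE // diffZl //= -deriveE // derive_val.
have := is_deriveD (is_deriveD (is_derive_cst Q (0 : R) 1) (dZ f a w df))
  (dZ h b z dh).
by rewrite add0r.
Qed.

(** Finite sets are closed, so a curve starting outside [F] stays outside for small [t]; this takes
    care of the punctures. *)
Lemma finite_set_avoided {R : realType} (F : set 'rV[R]_2) (g : R -> 'rV[R]_2)
    (w : 'rV[R]_2) :
  finite_set F -> ~ F (g 0) -> is_derive (0 : R) 1 g w ->
  \forall t \near (0 : R), ~ F (g t).
Proof.
move=> finF nFg dg.
have cg : {for 0, continuous g}.
  by apply/differentiable_continuous/derivable1_diffP; case: dg.
have clF : closed F.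
  move: F finF {nFg}; apply/accessible_finite_set_closed.
  exact/hausdorff_accessible/norm_hausdorff.
have oF : open (~` F) by apply: closed_openC.
have : nbhs (g 0) (~` F) by apply: open_nbhs_nbhs.
by move=> /cg.
Qed.

Lemma billiard_reflection_linear {R : realType} (C : set 'rV[R]_2)
    (N : 'rV[R]_2 -> 'rV[R]_2) (Q w : 'rV[R]_2) (M : 'M[R]_2)
    (b : 'rV[R]_2) :
  tangent_vector C Q w -> billiard_reflection C N Q M b ->
  w *m M = w /\ N Q *m M = - N Q.
Proof.
move=> tw [_ sw sN].
(* The case [k = 0]: the reflection fixes [Q], which eliminates [b]. *)
have := sN 0; rewrite scale0r addr0 subr0 => sQ.
split.
  have := sw w tw; rewrite /= mulmxDl -addrA [w *m M + b]addrC addrA sQ.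
  by move/addrI.
have := sN 1; rewrite scale1r /= mulmxDl -addrA [N Q *m M + b]addrC addrA sQ.
by move/addrI.
Qed.

(** Were the determinant zero, [N Q] would be a multiple of [w], hence tangent to [C]. The
    coefficients come from Cramer's rule. *)
Lemma transversal_decomposition {R : realType} (C : set 'rV[R]_2)
    (N : 'rV[R]_2 -> 'rV[R]_2) (Q w v : 'rV[R]_2) :
  transversal_field C N -> C Q -> tangent_vector C Q w -> w != 0 ->
  crd1 w * crd2 (N Q) - crd2 w * crd1 (N Q) != 0 /\
  exists a b : R, v = a *: w + b *: N Q.
Proof.
move=> trN CQ tw w0.
have det0 : crd1 w * crd2 (N Q) - crd2 w * crd1 (N Q) != 0.
  apply/eqP => det0; apply: (trN Q CQ).
  have [w10|w10] := eqVneq (crd1 w) 0.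
    have w20 : crd2 w != 0.
      apply: contra_neq w0 => w20; apply: crd_inj.
        by rewrite w10 /crd1 mxE.
      by rewrite w20 /crd2 mxE.
    suff -> : N Q = (crd2 (N Q) / crd2 w) *: w by exact: tangent_vectorZ.
    apply: crd_inj; rewrite !crdE; last by rewrite divfK.
    rewrite w10 mulr0; move/eqP: det0.
    by rewrite w10 mul0r sub0r oppr_eq0 mulf_eq0 (negbTE w20) => /eqP.
  suff -> : N Q = (crd1 (N Q) / crd1 w) *: w by exact: tangent_vectorZ.
  apply: crd_inj; rewrite !crdE; first by rewrite divfK.
  apply: (mulfI w10); rewrite mulrA mulrCA mulrAC -mulrA divff // mulr1.
  by move/eqP: det0; rewrite subr_eq0 => /eqP ->; rewrite mulrC.
split => //.
exists ((crd1 v * crd2 (N Q) - crd2 v * crd1 (N Q))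
        / (crd1 w * crd2 (N Q) - crd2 w * crd1 (N Q))).
exists ((crd1 w * crd2 v - crd2 w * crd1 v)
        / (crd1 w * crd2 (N Q) - crd2 w * crd1 (N Q))).
by apply: crd_inj; rewrite !crdE; field.
Qed.

(** * First integrals in the moments *)

Lemma Delta_free {R : realType} (x v : 'rV[R]_2) (t : R) :
  Delta (x + t *: v) v = Delta x v.
Proof. by rewrite /Delta !crdE; ring. Qed.

(** One nonzero tangent vector at each point suffices: with [N Q] it forms a basis in which the
    reflection reverses only the second coordinate. *)
Lemma first_integral_in_moments {R : realType} (C : set 'rV[R]_2)
    (N : 'rV[R]_2 -> 'rV[R]_2) (P P' : R -> R -> R -> R) :
  transversal_field C N ->
  (forall Q, C Q -> exists w, [/\ tangent_vector C Q w, w != 0 &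
     forall a b : R,
       in_moments P Q (a *: w - b *: N Q) = in_moments P Q (a *: w + b *: N Q)
       /\ in_moments P' Q (a *: w - b *: N Q)
          = in_moments P' Q (a *: w + b *: N Q)]) ->
  first_integral C N (in_moments P) (in_moments P').
Proof.
move=> trN sym.
have free (P0 : R -> R -> R -> R) (x v : 'rV[R]_2) (t : R) :
    in_moments P0 (x + t *: v) v = in_moments P0 x v.
  by rewrite /in_moments Delta_free.
suff inv p q : billiard_flow C N p q ->
    in_moments P q.1 q.2 = in_moments P p.1 p.2 /\
    in_moments P' q.1 q.2 = in_moments P' p.1 p.2.
  (* Numerator and denominator are conserved separately, so the common factor is [1]. *)
  move=> x v x' v' /inv[/= -> ->]; exists 1.
  by rewrite oner_eq0 !mul1r.
elim=> [//|x v t _ [/= e e'] _ _|x v t M b _ [/= e e'] _ _ CQ refl].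
  by rewrite !free.
(* The incoming values are transported from [x] to the point of impact. *)
rewrite /= -e -e' -(free P x v t) -(free P' x v t).
move: (x + t *: v) CQ refl => Q CQ refl.
have [w [tw w0 wP]] := sym Q CQ.
have [_ [a [c ->]]] := transversal_decomposition _ _ _ _ v trN CQ tw w0.
have [wM NM] := billiard_reflection_linear _ _ _ _ _ _ tw refl.
by rewrite mulmxDl -!scalemxAl wM NM scalerN; apply: wP.
Qed.

(** * Homogeneous polynomials in the velocity *)

Lemma homogeneous_poly_ext {R : realType} (d : nat) (f g : 'rV[R]_2 -> R) :
  f =1 g -> homogeneous_poly d f -> homogeneous_poly d g.
Proof. by move=> fg [a fa]; exists a => v; rewrite -fg. Qed.

Lemma homogeneous_poly_cst {R : realType} (k : R) :
  homogeneous_poly 0 (fun _ : 'rV[R]_2 => k).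
Proof.
by exists (fun=> k) => v; rewrite big_ord1 !expr0 !mulr1.
Qed.

Lemma homogeneous_poly_crd1 {R : realType} : homogeneous_poly 1 (@crd1 R).
Proof.
exists (fun i => (i == 1%N)%:R) => v.
by rewrite big_ord_recl big_ord1 /= mul0r mul0r add0r mul1r expr1 mulr1.
Qed.

Lemma homogeneous_poly_crd2 {R : realType} : homogeneous_poly 1 (@crd2 R).
Proof.
exists (fun i => (i == 0%N)%:R) => v.
by rewrite big_ord_recl big_ord1 /= mul0r mul0r addr0 mul1r expr0 mul1r.
Qed.

(** The two degrees are linked by an equation because degrees inferred for two summands, such as
    [1 + 1] and [2 * 1], may differ in form. *)
Lemma homogeneous_polyD {R : realType} (d d' : nat) (f g : 'rV[R]_2 -> R) :
  homogeneous_poly d f -> homogeneous_poly d' g -> d' = d ->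
  homogeneous_poly d (fun v => f v + g v).
Proof.
move=> [a fa] [b gb] dd; subst d'; exists (fun i => a i + b i) => v.
by rewrite fa gb -big_split; apply: eq_bigr => i _ /=; rewrite !mulrDl.
Qed.

Lemma homogeneous_polyZ {R : realType} (d : nat) (k : R) (f : 'rV[R]_2 -> R) :
  homogeneous_poly d f -> homogeneous_poly d (fun v => k * f v).
Proof.
move=> [a fa]; exists (fun i => k * a i) => v.
by rewrite fa mulr_sumr; apply: eq_bigr => i _; rewrite !mulrA.
Qed.

Lemma homogeneous_polyN {R : realType} (d : nat) (f : 'rV[R]_2 -> R) :
  homogeneous_poly d f -> homogeneous_poly d (fun v => - f v).
Proof.
by move/(homogeneous_polyZ _ (-1)); apply: homogeneous_poly_ext => v;
  rewrite mulN1r.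
Qed.

Lemma homogeneous_polyM {R : realType} (d d' : nat) (f g : 'rV[R]_2 -> R) :
  homogeneous_poly d f -> homogeneous_poly d' g ->
  homogeneous_poly (d + d') (fun v => f v * g v).
Proof.
move=> [a fa] [b gb].
have sumP (I : Type) (r : seq I) (F : I -> 'rV[R]_2 -> R) :
    (forall i, homogeneous_poly (d + d') (F i)) ->
    homogeneous_poly (d + d') (fun v => \sum_(i <- r) F i v).
  move=> hF; elim: r => [|i r ih].
    apply: homogeneous_poly_ext (homogeneous_polyZ _ 0 _ (_ : homogeneous_poly
      (d + d') (fun=> \sum_(i < (d + d').+1) 0))) => [v|].
      by rewrite mul0r big_nil.
    by exists (fun=> 0) => v; apply: eq_bigr => i _; rewrite !mul0r.
  apply: homogeneous_poly_ext (homogeneous_polyD _ _ _ _ (hF i) ih erefl) => v.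
  by rewrite big_cons.
(* The expanded product is a double sum of monomials, each of degree [d + d']. *)
apply: (@homogeneous_poly_ext _ _ (fun v => \sum_(i <- index_enum 'I_d.+1)
   \sum_(j <- index_enum 'I_d'.+1)
   (a i * b j) * (crd1 v ^+ (i + j) * crd2 v ^+ (d + d' - (i + j))))).
  move=> v; rewrite fa gb mulr_suml; apply: eq_bigr => i _.
  rewrite mulr_sumr; apply: eq_bigr => j _.
  have -> : (d + d' - (i + j) = (d - i) + (d' - j))%N.
    by have := ltn_ord i; have := ltn_ord j; lia.
  by rewrite !exprD; ring.
apply: (sumP) => i; apply: (sumP) => j; apply: homogeneous_polyZ.
exists (fun k => (k == i + j)%N%:R) => v.
have ij : (i + j < (d + d').+1)%N.
  by have := ltn_ord i; have := ltn_ord j; lia.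
rewrite (bigD1 (Ordinal ij)) //= eqxx mul1r big1 ?addr0 // => k /negbTE kij.
by rewrite -(inj_eq val_inj) /= in kij; rewrite kij !mul0r.
Qed.

Lemma homogeneous_polyX {R : realType} (d n : nat) (f : 'rV[R]_2 -> R) :
  homogeneous_poly d f -> homogeneous_poly (n * d) (fun v => f v ^+ n).
Proof.
move=> hf; elim: n => [|n ih].
  by apply: homogeneous_poly_ext (homogeneous_poly_cst 1).
apply: homogeneous_poly_ext (homogeneous_polyM _ _ _ _ hf ih) => v.
by rewrite exprS.
Qed.

Lemma homogeneous_poly_prod {R : realType} (d n : nat)
    (f : nat -> 'rV[R]_2 -> R) :
  (forall j, homogeneous_poly d (f j)) ->
  homogeneous_poly (n * d) (fun v => \prod_(1 <= j < n.+1) f j v).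
Proof.
move=> hf; elim: n => [|n ih].
  apply: homogeneous_poly_ext (homogeneous_poly_cst 1) => v.
  by rewrite big_nat_cond big1 // => j; lia.
apply: homogeneous_poly_ext (homogeneous_polyM _ _ _ _ (hf n.+1) ih) => v.
by rewrite [in RHS]big_nat_recr //= mulrC.
Qed.

Lemma homogeneous_poly_Delta {R : realType} (x : 'rV[R]_2) :
  homogeneous_poly 1 (Delta x).
Proof.
apply: homogeneous_polyD (erefl 1%N).
  exact/homogeneous_polyZ/homogeneous_poly_crd2.
exact/homogeneous_polyN/homogeneous_polyZ/homogeneous_poly_crd1.
Qed.

Lemma homogeneous_poly_eqdeg {R : realType} (d d' : nat)
    (f : 'rV[R]_2 -> R) :
  homogeneous_poly d f -> d = d' -> homogeneous_poly d' f.
Proof. by move=> hf <-. Qed.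

(** The degree is an existential variable filled in by recursion on the formula; [homogeneous] then
    compares it with the expected one by [lia]. *)
Ltac homogeneous_rec := first
  [ exact: homogeneous_poly_crd1 | exact: homogeneous_poly_crd2
  | exact: homogeneous_poly_Delta | exact: homogeneous_poly_cst
  | eapply homogeneous_polyX; homogeneous_rec
  | eapply homogeneous_polyM; homogeneous_rec
  | eapply homogeneous_polyN; homogeneous_rec
  | eapply homogeneous_polyD;
      [homogeneous_rec | homogeneous_rec | try reflexivity]
  | eapply homogeneous_poly_prod; intro; homogeneous_rec ].

Ltac homogeneous := rewrite /in_moments;
  eapply homogeneous_poly_eqdeg; [homogeneous_rec | try lia].

(** * Genericity and nonconstancy *)

Lemma dense_affine_neq0 {R : realType} (a b c : R) (S : set 'rV[R]_2) :
  [|| a != 0, b != 0 | c != 0] ->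
  (forall x, a * crd1 x + b * crd2 x + c != 0 -> S x) -> dense S.
Proof.
move=> abc sub O [x Ox] oO.
have [lx|lx] := eqVneq (a * crd1 x + b * crd2 x + c) 0; last first.
  by exists x; split => //; apply: sub.
(* At a zero of the affine form, [a = b = 0] would force [c = 0]. *)
have ab : a ^+ 2 + b ^+ 2 != 0.
  apply: contraTneq abc => /eqP; rewrite paddr_eq0 ?sqr_ge0 // !sqrf_eq0.
  by case/andP=> /eqP a0 /eqP b0; move: lx; rewrite a0 b0 !mul0r !add0r => ->;
    rewrite eqxx.
have cx : {for 0, continuous (fun s : R => x + s *: vec2 a b)}.
  by apply: continuousD; [exact: cst_continuous | exact: scalel_continuous].
have nO : nbhs (x + 0 *: vec2 a b) O.
  by rewrite scale0r addr0; apply: open_nbhs_nbhs.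
have /nbhs_ballP [e /= e0 eO] := cx O nO.
have e20 : e / 2 != 0 by rewrite gt_eqF // divr_gt0.
(* A step along the gradient [(a, b)] from a zero gives the value [e / 2 * (a ^+ 2 + b ^+ 2)]. *)
exists (x + (e / 2) *: vec2 a b); split.
  apply: eO; rewrite /ball /= sub0r normrN gtr0_norm ?divr_gt0 //.
  by rewrite ltr_pdivrMr // ltr_pMr // ltr1n.
apply: sub; rewrite !crdE.
suff -> : a * (crd1 x + e / 2 * a) + b * (crd2 x + e / 2 * b) + c
    = (e / 2) * (a ^+ 2 + b ^+ 2) by rewrite mulf_neq0.
by rewrite -[RHS]addr0 -lx; ring.
Qed.

(* As [v1 != 0], the moments are those of v = (v1, v2) at x = (0, - D / v1). *)
Lemma nonconstant_in_moments {R : realType} (P P' : R -> R -> R -> R)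
    (v1 v2 D u1 u2 E : R) :
  v1 != 0 -> u1 != 0 -> P' v1 v2 D != 0 -> P' u1 u2 E != 0 ->
  P v1 v2 D / P' v1 v2 D != P u1 u2 E / P' u1 u2 E ->
  nonconstant (in_moments P) (in_moments P').
Proof.
move=> v10 u10 dv du neq.
exists (vec2 0 (- D / v1)), (vec2 v1 v2), (vec2 0 (- E / u1)), (vec2 u1 u2).
rewrite /in_moments /Delta !crdE !mul0r !sub0r !divfK // !opprK.
by split.
Qed.

(** * Billiards on the parabola *)

Lemma vec2_neq0 {R : realType} (a b : R) : a != 0 -> vec2 a b != 0.
Proof.
apply: contra_neq => /(congr1 (@crd1 R)); rewrite crdE => ->.
by rewrite /crd1 mxE.
Qed.

Lemma tangent_parabola {R : realType} (F : set 'rV[R]_2) (Q : 'rV[R]_2) :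
  finite_set F -> punctured_parabola F Q ->
  tangent_vector (punctured_parabola F) Q (vec2 1 (2 * crd1 Q)).
Proof.
move=> finF [/= Q2 nFQ].
(* The parabola parametrized by its first coordinate [crd1 Q + t]; the formula is exact. *)
pose g := fun t : R => Q + t *: vec2 1 (2 * crd1 Q) + t ^+ 2 *: vec2 0 1.
have g0 : g 0 = Q by rewrite /g expr0n /= !scale0r !addr0.
have dg : is_derive (0 : R) 1 g (vec2 1 (2 * crd1 Q)).
  have d2 : is_derive (0 : R) 1 (fun t : R => t ^+ 2) 0.
    have := @is_deriveX R R id 2 0 1 1 (is_derive_id _ _).
    by rewrite mulr0 scale0r.
  have := is_derive_moving_combination Q (vec2 1 (2 * crd1 Q)) (vec2 0 1)
    id (fun t => t ^+ 2) 1 0 (is_derive_id (0 : R) 1) d2.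
  by rewrite scale1r scale0r addr0.
exists g; split => //.
have nF0 : ~ F (g 0) by rewrite g0.
apply: filterS (finite_set_avoided _ _ _ finF nF0 dg) => t nFt; split => //=.
by rewrite /g !crdE Q2; ring.
Qed.

(* On the parabola [4 v1 D - v2^2 = - (v2 - 2 x1 v1)^2]: up to sign it is the
   square of a linear form vanishing on the tangent line, hence invariant. *)
Lemma parabola_integral {R : realType} (F : set 'rV[R]_2)
    (N : 'rV[R]_2 -> 'rV[R]_2) (k : nat) (P : R -> R -> R -> R)
    (a0 b0 c0 v1 v2 u1 u2 E : R) :
  finite_set F -> transversal_field (punctured_parabola F) N ->
  (forall x, homogeneous_poly (k * 2) (in_moments P x)) ->
  [|| a0 != 0, b0 != 0 | c0 != 0] ->
  (forall x, a0 * crd1 x + b0 * crd2 x + c0 != 0 ->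
     exists v, in_moments P x v != 0) ->
  (0 < k)%N -> v1 != 0 -> u1 != 0 -> P v1 v2 (v2 ^+ 2 / (4 * v1)) != 0 ->
  P u1 u2 E != 0 -> 4 * u1 * E - u2 ^+ 2 != 0 ->
  (forall q a b : R,
     let n1 := crd1 (N (vec2 q (q ^+ 2))) in
     let n2 := crd2 (N (vec2 q (q ^+ 2))) in
     n2 - 2 * q * n1 != 0 ->
     P (a - b * n1) (2 * q * a - b * n2)
       (q ^+ 2 * a - b * (q * n2 - q ^+ 2 * n1))
     = P (a + b * n1) (2 * q * a + b * n2)
         (q ^+ 2 * a + b * (q * n2 - q ^+ 2 * n1))) ->
  rational_0homogeneous_integral (punctured_parabola F) N
    (in_moments (fun v1 v2 D => (4 * v1 * D - v2 ^+ 2) ^+ k)) (in_moments P).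
Proof.
move=> finF trN homP abc genP k0 v10 u10 Pv Pu nu symP; split.
- split; first by exists (k * 2)%N => x; split => //; homogeneous.
  (* For [v = (0, 1)] the base of the numerator is [-1], whatever [x] is. *)
  + move=> x; exists (vec2 0 1); left.
    rewrite /in_moments /Delta !crdE expf_neq0 //.
    by rewrite mulr0 mul0r sub0r oppr_eq0 expf_neq0 // oner_neq0.
  + exact: dense_affine_neq0 abc genP.
(* The value [D = v2 ^+ 2 / (4 * v1)] annihilates the numerator, so the ratio is [0] there; it is
   nonzero at [(u1, u2, E)]. *)
- apply: (nonconstant_in_moments _ _ v1 v2 (v2 ^+ 2 / (4 * v1)) u1 u2 E) => //.
  have -> : 4 * v1 * (v2 ^+ 2 / (4 * v1)) - v2 ^+ 2 = 0 by field.
  rewrite expr0n eqn0Ngt k0 /= mul0r eq_sym mulf_neq0 ?invr_eq0 //.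
  exact: expf_neq0.
- apply: (first_integral_in_moments _ _ _ _ trN) => Q CQ.
  have tw := tangent_parabola F Q finF CQ.
  have w0 : vec2 1 (2 * crd1 Q) != 0 by rewrite vec2_neq0 ?oner_neq0.
  exists (vec2 1 (2 * crd1 Q)); split => // a b.
  have [det0 _] := transversal_decomposition _ _ _ _ 0 trN CQ tw w0.
  have eQ : Q = vec2 (crd1 Q) (crd1 Q ^+ 2).
    by case: CQ => /= Q2 _; apply: crd_inj; rewrite !crdE.
  move: (crd1 Q) eQ det0 => q ->; rewrite !crdE mul1r => det0.
  have := symP q a b det0.
  rewrite /in_moments /Delta !crdE => symq; split.
    by congr (_ ^+ k); ring.
  rewrite !mulr1 !(mulrC a); move: symq; congr (P _ _ _ = P _ _ _); ring.
Qed.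

(** * The five exceptional billiards on the parabola *)

Lemma integral_2b1 {R : realType} (F : set 'rV[R]_2) (N := fun x : 'rV[R]_2 =>
    vec2 (5 * crd1 x + 3) (2 * (crd2 x - crd1 x))) :
  finite_set F -> transversal_field (punctured_parabola F) N ->
  rational_0homogeneous_integral (punctured_parabola F) N
    (in_moments (fun v1 v2 D => (4 * v1 * D - v2 ^+ 2) ^+ 2))
    (in_moments (fun v1 v2 D =>
       (4 * v1 * D + 3 * v2 ^+ 2) * (2 * v1 + v2) * (2 * D + v2))).
Proof.
move=> finF trN.
(* At [v = (0, 1)] the denominator is [3 * (2 * x1 + 1)], whence the affine form. The moments
   [(1, 2, 1)] annihilate the numerator and [(1, 0, 1)] do not. *)
apply: (parabola_integral F N 2 _ 2 0 1 1 2 1 0 1) => //;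
  try by rewrite lt0r_neq0 //=; lra.
- by move=> x; homogeneous.
- move=> x x0; exists (vec2 0 1); rewrite /in_moments /Delta !crdE.
  by apply: contra_neq x0; lra.
(* The denominator restricts to [64 q^3 (q+1)^2 (a^2 - (q+3)^2 b^2) (a^2 - (3q+1)^2 b^2)]. *)
- move=> q a b /= _; rewrite !crdE; ring.
Qed.

(** At [(q, q^2)] the factors are [4 (q^2+1)^2 ((a - q b)^2 + 4 b^2)] and
    [4 (q^2+1) ((a + q b)^2 + 4 b^2)]: up to constants, [b -> -b] exchanges them. At [v = (0, 1)]
    the denominator is positive, so the affine form is the constant [1]. *)
Lemma integral_2b2 {R : realType} (F : set 'rV[R]_2) (N := fun x : 'rV[R]_2 =>
    vec2 (3 * crd1 x) (2 * crd2 x - 4)) :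
  finite_set F -> transversal_field (punctured_parabola F) N ->
  rational_0homogeneous_integral (punctured_parabola F) N
    (in_moments (fun v1 v2 D => (4 * v1 * D - v2 ^+ 2) ^+ 2))
    (in_moments (fun v1 v2 D =>
       (v2 ^+ 2 + 4 * D ^+ 2 + 4 * v1 * D + 4 * v1 ^+ 2)
       * (v2 ^+ 2 + 4 * v1 ^+ 2))).
Proof.
move=> finF trN.
apply: (parabola_integral F N 2 _ 0 0 1 1 0 1 0 1) => //;
  try by rewrite lt0r_neq0 //=; lra.
- by move=> x; homogeneous.
- by rewrite oner_eq0 !orbT.
- move=> x _; exists (vec2 0 1); rewrite /in_moments /Delta !crdE.
  by rewrite lt0r_neq0 //; have := sqr_ge0 (crd1 x); nra.
- move=> q a b /= _; rewrite !crdE; ring.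
Qed.

(** The cubic restricts to [(q^3+1)^2 a (a^2 + q b^2)], already even in [b]; squaring it matches the
    degree of the numerator. *)
Lemma integral_2c1 {R : realType} (F : set 'rV[R]_2) (N := fun x : 'rV[R]_2 =>
    vec2 (crd2 x) (crd1 x * crd2 x - 1)) :
  finite_set F -> transversal_field (punctured_parabola F) N ->
  rational_0homogeneous_integral (punctured_parabola F) N
    (in_moments (fun v1 v2 D => (4 * v1 * D - v2 ^+ 2) ^+ 3))
    (in_moments (fun v1 v2 D => (v1 ^+ 3 + D ^+ 3 + v1 * v2 * D) ^+ 2)).
Proof.
move=> finF trN.
apply: (parabola_integral F N 3 _ 1 0 0 1 0 1 0 1) => //;
  try by rewrite lt0r_neq0 //=; lra.
- by move=> x; homogeneous.
- move=> x x0; exists (vec2 0 1); rewrite /in_moments /Delta !crdE.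
  rewrite !mul0r mul1r !addr0 in x0.
  by rewrite mulr1 mulr0 subr0 !mul0r expr0n addr0 add0r !expf_neq0.
- move=> q a b /= _; rewrite !crdE; ring.
Qed.

(** The cubic restricts to [9 q^2 (q+1)^2 a (a^2 - (q^2+q+1) b^2)]. *)
Lemma integral_2c2 {R : realType} (F : set 'rV[R]_2) (N := fun x : 'rV[R]_2 =>
    vec2 (2 * crd1 x + 1) (crd2 x - crd1 x)) :
  finite_set F -> transversal_field (punctured_parabola F) N ->
  rational_0homogeneous_integral (punctured_parabola F) N
    (in_moments (fun v1 v2 D => (4 * v1 * D - v2 ^+ 2) ^+ 3))
    (in_moments (fun v1 v2 D =>
       (v2 ^+ 3 + 2 * v2 ^+ 2 * v1
        + (v1 ^+ 2 + 2 * v2 ^+ 2 + 5 * v1 * v2) * D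
        + v1 * D ^+ 2) ^+ 2)).
Proof.
move=> finF trN.
apply: (parabola_integral F N 3 _ 2 0 1 1 2 1 0 1) => //;
  try by rewrite lt0r_neq0 //=; lra.
- by move=> x; homogeneous.
- move=> x x0; exists (vec2 0 1); rewrite /in_moments /Delta !crdE expf_neq0 //.
  by apply: contra_neq x0; lra.
- move=> q a b /= _; rewrite !crdE; ring.
Qed.

(** The first two factors restrict to [9 q^2 (a - (q+4) b) (a + 3 q b)] and [2 (q+1) (a + (q+4) b)];
    the cubic supplies the missing [a - 3 q b], times a form even in [b]. *)
Lemma integral_2d {R : realType} (F : set 'rV[R]_2) (N := fun x : 'rV[R]_2 =>
    vec2 (7 * crd1 x + 4) (2 * crd2 x - 4 * crd1 x)) :
  finite_set F -> transversal_field (punctured_parabola F) N ->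
  rational_0homogeneous_integral (punctured_parabola F) N
    (in_moments (fun v1 v2 D => (4 * v1 * D - v2 ^+ 2) ^+ 3))
    (in_moments (fun v1 v2 D =>
       (v1 * D + 2 * v2 ^+ 2) * (2 * v1 + v2)
       * (8 * v1 * v2 ^+ 2 + 2 * v2 ^+ 3
          + (4 * v1 ^+ 2 + 5 * v2 ^+ 2 + 28 * v1 * v2) * D
          + 16 * v1 * D ^+ 2))).
Proof.
move=> finF trN.
apply: (parabola_integral F N 3 _ 5 0 2 1 2 1 0 1) => //;
  try by rewrite lt0r_neq0 //=; lra.
- by move=> x; homogeneous.
- move=> x x0; exists (vec2 0 1); rewrite /in_moments /Delta !crdE.
  by apply: contra_neq x0; lra.
- move=> q a b /= _; rewrite !crdE; ring.
Qed.

(** * The two infinite series on the parabola *)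

Lemma prod_nat_rev1 {R : comPzRingType} (n : nat) (f : nat -> R) :
  \prod_(1 <= k < n.+1) f k = \prod_(1 <= k < n.+1) f (n.+1 - k)%N.
Proof. by rewrite big_nat_rev; apply: eq_bigr => k _; rewrite add1n subSS. Qed.

(** Telescoping: [y + (k - 1) b] from index [k] pairs with [y - (k - 1) b] from index [k - 1]. Index
    [1] leaves a lone [y], and the extra factor completes the pair of index [n]. *)
Lemma prod_opposite_pairs {R : comPzRingType} (n : nat) (y b : R) :
  (y + n%:R * b) *
  \prod_(1 <= k < n.+1) ((y - k%:R * b) * (y + (k%:R - 1) * b))
  = y * \prod_(1 <= k < n.+1) (y ^+ 2 - (k%:R * b) ^+ 2).
Proof.
elim: n => [|n ih]; first by rewrite !big_geq // mul0r addr0.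
rewrite !(big_nat_recr n.+1) //= [RHS]mulrA -ih -natr1; ring.
Qed.

(** The same telescoping along odd multiples of [b]; here both ends need an extra factor. *)
Lemma prod_opposite_odd_pairs {R : comPzRingType} (n : nat) (y b : R) :
  (y + (2 * n%:R + 1) * b) * (y - b) *
  \prod_(1 <= k < n.+1)
     ((y - (2 * k%:R + 1) * b) * (y + (2 * k%:R - 1) * b))
  = \prod_(0 <= k < n.+1) (y ^+ 2 - ((2 * k%:R + 1) * b) ^+ 2).
Proof.
elim: n => [|n ih]; first by rewrite big_geq // big_nat1; ring.
rewrite (big_nat_recr n.+1) //= [RHS](big_nat_recr n.+1) //= -ih -natr1; ring.
Qed.

Lemma integral_2a1 {R : realType} (F : set 'rV[R]_2) (n : nat)
    (rho : R := 2 - 2 / (2 * n%:R + 1))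
    (c := fun j : nat => - (4 * j%:R * (2 * n%:R + 1 - j%:R))
       / (2 * n%:R + 1 - 2 * j%:R) ^+ 2 : R)
    (N := fun x : 'rV[R]_2 => vec2 rho (2 * (rho - 2) * crd1 x)) :
  finite_set F -> transversal_field (punctured_parabola F) N ->
  rational_0homogeneous_integral (punctured_parabola F) N
    (in_moments (fun v1 v2 D => (4 * v1 * D - v2 ^+ 2) ^+ (2 * n + 1)))
    (in_moments (fun v1 v2 D => v1 ^+ 2 *
       \prod_(1 <= j < n.+1) (4 * v1 * D - c j * v2 ^+ 2) ^+ 2)).
Proof.
move=> finF trN.
have n0 : 0 <= n%:R :> R by rewrite ler0n.
have jn j : (1 <= j < n.+1)%N -> 1 <= j%:R :> R /\ j%:R <= n%:R :> R.
  by rewrite ltnS !ler_nat ler1n => /andP.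
have c0 j : (1 <= j < n.+1)%N -> c j <= 0.
  move=> /jn[j1 jn'].
  by rewrite /c mulNr oppr_le0 divr_ge0 ?sqr_ge0 // mulr_ge0; lra.
have prod0 (f : nat -> R) : (forall j, (1 <= j < n.+1)%N -> f j != 0) ->
    \prod_(1 <= j < n.+1) f j ^+ 2 != 0.
  move=> f0; rewrite big_nat_cond prodf_seq_neq0; apply/allP => j _.
  by apply/implyP; rewrite andbT => /f0 fj; rewrite expf_neq0.
(* At [v = (1, 0)] each factor is [- 4 * x2], whence the affine form [x2]. As [c j <= 0], the
   factors are positive at the moments [(1, 1, 1/4)] and [(1, 1, 1)]. *)
apply: (parabola_integral F N (2 * n + 1) _ 0 1 0 1 1 1 1 1) => //.
- by move=> x; homogeneous.
- by rewrite oner_eq0 orbT.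
- move=> x x0; exists (vec2 1 0); rewrite /in_moments /Delta !crdE.
  rewrite !(mul0r, mul1r, add0r, addr0) in x0.
  rewrite expr1n mul1r; apply: prod0 => j _.
  rewrite expr0n /= !mulr0 subr0 sub0r !mulr1 mulrN oppr_eq0.
  by rewrite mulf_neq0 // pnatr_eq0.
- by rewrite addn1.
- rewrite expr1n mul1r; apply: prod0 => j /c0; move: (c j) => d d0.
  by rewrite lt0r_neq0 //; lra.
- rewrite expr1n mul1r; apply: prod0 => j /c0; move: (c j) => d d0.
  by rewrite lt0r_neq0 //; lra.
move=> q a b; rewrite /= !crdE => _.
pose m : R := 2 * n%:R + 1.
have m0 : m != 0 by rewrite lt0r_neq0 // /m; lra.
have rhoE : rho = 2 - 2 / m by [].
(* The [j]-th factor at the velocity [a w + e N]; [e] will be [b] and [- b]. *)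
pose f j e := 4 * (a + e * rho) * (q ^+ 2 * a
         + e * (q * (2 * (rho - 2) * q) - q ^+ 2 * rho))
      - c j * (2 * q * a + e * (2 * (rho - 2) * q)) ^+ 2.
pose k j := 4 * q ^+ 2 / (m - 2 * j%:R) ^+ 2.
(* Each factor splits into linear forms in [m * a] and [4 * e], indexed by [n.+1 - j]; hence the
   reversal of the product below. *)
have fE j e : (1 <= j < n.+1)%N -> f j e =
    k j * ((m * a - (n.+1 - j)%:R * (4 * e))
           * (m * a + ((n.+1 - j)%:R - 1) * (4 * e))).
  move=> /[dup] /jn[j1 jn'] /andP[_ jn1].
  have mj : m - 2 * j%:R != 0 by rewrite lt0r_neq0 // /m; lra.
  rewrite natrB ?(ltnW jn1) // -(natr1 n) /f /k /c -/m rhoE.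
  have -> : n%:R = (m - 1) / 2 :> R by rewrite /m; field.
  by field; rewrite mj m0.
(* Since [rho = 4 n / m], the moment [v1] is the unpaired form [m * a + n * (4 * e)] divided by
   [m]. *)
have even e : (a + e * rho) * \prod_(1 <= j < n.+1) f j e =
    (\prod_(1 <= j < n.+1) k j) / m * (m * a *
       \prod_(1 <= i < n.+1) ((m * a) ^+ 2 - (i%:R * (4 * e)) ^+ 2)).
  rewrite -prod_opposite_pairs prod_nat_rev1 (eq_big_nat _ _ (fE^~ e)).
  rewrite big_split /=; have -> : a + e * rho = (m * a + n%:R * (4 * e)) / m.
    have nE : n%:R = (m - 1) / 2 :> R by rewrite /m; field.
    by rewrite rhoE nE; field.
  by rewrite mulrACA [_ / m * _]mulrAC; ring.
have evenN : (a + - b * rho) * \prod_(1 <= j < n.+1) f j (- b)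
    = (a + b * rho) * \prod_(1 <= j < n.+1) f j b.
  rewrite !even; congr (_ * (_ * _)); apply: eq_bigr => i _.
  by rewrite !mulrN sqrrN.
(* The denominator is the square of the even product. *)
by rewrite !prodrXl -!exprMn -!(mulNr b) evenN.
Qed.

Lemma integral_2a2 {R : realType} (F : set 'rV[R]_2) (n : nat)
    (rho : R := 2 - 1 / (n%:R + 1))
    (c := fun j : nat => - (j%:R * (2 * n%:R + 2 - j%:R))
       / (n%:R + 1 - j%:R) ^+ 2 : R)
    (N := fun x : 'rV[R]_2 => vec2 rho (2 * (rho - 2) * crd1 x)) :
  finite_set F -> transversal_field (punctured_parabola F) N ->
  rational_0homogeneous_integral (punctured_parabola F) N
    (in_moments (fun v1 v2 D => (4 * v1 * D - v2 ^+ 2) ^+ (n + 1)))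
    (in_moments (fun v1 v2 D => v1 * v2 *
       \prod_(1 <= j < n.+1) (4 * v1 * D - c j * v2 ^+ 2))).
Proof.
move=> finF trN.
have n0 : 0 <= n%:R :> R by rewrite ler0n.
have jn j : (1 <= j < n.+1)%N -> 1 <= j%:R :> R /\ j%:R <= n%:R :> R.
  by rewrite ltnS !ler_nat ler1n => /andP.
have c0 j : (1 <= j < n.+1)%N -> c j < 0.
  move=> /jn[j1 jn'].
  by rewrite /c mulNr oppr_lt0 divr_gt0 ?exprn_gt0 ?mulr_gt0 //; lra.
have prod0 (f : nat -> R) : (forall j, (1 <= j < n.+1)%N -> f j != 0) ->
    \prod_(1 <= j < n.+1) f j != 0.
  move=> f0; rewrite big_nat_cond prodf_seq_neq0; apply/allP => j _.
  by apply/implyP; rewrite andbT => /f0 fj.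
apply: (parabola_integral F N (n + 1) _ 1 0 0 1 1 1 1 1) => //.
- by move=> x; homogeneous.
- by rewrite oner_eq0.
- move=> x; rewrite !(mul0r, mul1r, addr0) => x0.
  (* This slope makes [v1 * Delta = t ^+ 2 * (1 + x2 ^+ 2 - x2)] nonnegative at [v = (t, 1)], so
     every factor is positive because [c j < 0]. *)
  pose t := crd1 x / (1 + crd2 x ^+ 2).
  have d0 : 0 < 1 + crd2 x ^+ 2 by rewrite ltr_pwDl // sqr_ge0.
  have t0 : t != 0 by rewrite mulf_neq0 // invr_eq0 gt_eqF.
  exists (vec2 t 1); rewrite /in_moments /Delta !crdE !mulr1 expr1n.
  rewrite mulf_neq0 //; apply: prod0 => j /c0; move: (c j) => d cd.
  rewrite gt_eqF //.
  suff : 0 <= t * (crd1 x - crd2 x * t) by nra.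
  have -> : t * (crd1 x - crd2 x * t)
      = t ^+ 2 * (1 + crd2 x ^+ 2 - crd2 x).
    by rewrite /t; field; rewrite gt_eqF.
  by rewrite mulr_ge0 ?sqr_ge0 //; have := sqr_ge0 (2 * crd2 x - 1); nra.
- by rewrite addn1.
- rewrite !mul1r; apply: prod0 => j /c0; move: (c j) => d d0.
  by rewrite lt0r_neq0 //; lra.
- rewrite !mul1r; apply: prod0 => j /c0; move: (c j) => d d0.
  by rewrite lt0r_neq0 //; lra.
move=> q a b; rewrite /= !crdE => _.
pose m : R := n%:R + 1.
have m0 : m != 0 by rewrite lt0r_neq0 // /m; lra.
have rhoE : rho = 2 - 1 / m by [].
pose f j e := 4 * (a + e * rho) * (q ^+ 2 * a
         + e * (q * (2 * (rho - 2) * q) - q ^+ 2 * rho))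
      - c j * (2 * q * a + e * (2 * (rho - 2) * q)) ^+ 2.
pose k j := 4 * q ^+ 2 / (m - j%:R) ^+ 2.
have fE j e : (1 <= j < n.+1)%N -> f j e =
    k j * ((m * a - (2 * (n.+1 - j)%:R + 1) * e)
           * (m * a + (2 * (n.+1 - j)%:R - 1) * e)).
  move=> /[dup] /jn[j1 jn'] /andP[_ jn1].
  have mj : m - j%:R != 0 by rewrite lt0r_neq0 // /m; lra.
  rewrite natrB ?(ltnW jn1) // -(natr1 n) /f /k /c -/m rhoE.
  have -> : n%:R = m - 1 :> R by rewrite /m; ring.
  by field; rewrite mj m0.
(* Here [rho = (2 n + 1) / m]: [v1] and [v2] provide the two end factors of the odd telescoping. *)
have even e : (a + e * rho) * (2 * q * a + e * (2 * (rho - 2) * q))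
      * \prod_(1 <= j < n.+1) f j e =
    (\prod_(1 <= j < n.+1) k j) * (2 * q / m ^+ 2) *
       \prod_(0 <= i < n.+1) ((m * a) ^+ 2 - ((2 * i%:R + 1) * e) ^+ 2).
  rewrite -prod_opposite_odd_pairs prod_nat_rev1 (eq_big_nat _ _ (fE^~ e)).
  rewrite big_split /=.
  have -> : (a + e * rho) * (2 * q * a + e * (2 * (rho - 2) * q))
      = 2 * q / m ^+ 2 * ((m * a + (2 * n%:R + 1) * e) * (m * a - e)).
    have nE : n%:R = m - 1 :> R by rewrite /m; ring.
    by rewrite rhoE nE; field.
  by rewrite mulrACA [_ / _ * _ * _]mulrAC; ring.
have evenN : (a + - b * rho) * (2 * q * a + - b * (2 * (rho - 2) * q))
      * \prod_(1 <= j < n.+1) f j (- b)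
    = (a + b * rho) * (2 * q * a + b * (2 * (rho - 2) * q))
      * \prod_(1 <= j < n.+1) f j b.
  rewrite !even; congr (_ * _); apply: eq_bigr => i _.
  by rewrite !mulrN sqrrN.
by rewrite -!(mulNr b).
Qed.

(** * Space form billiards on conics *)

Lemma big_ord3 {R : nmodType} (f : 'I_3 -> R) :
  \sum_(i < 3) f i = f 0 + f 1 + f 2.
Proof.
rewrite !big_ord_recl big_ord0 addr0 addrA.
by congr (f _ + f _ + f _); apply: val_inj.
Qed.

Lemma ord3P (P : 'I_3 -> Prop) : P 0 -> P 1 -> P 2 -> forall i, P i.
Proof.
move=> P0 P1 P2 [[|[|[|//]]] lti]; [move: P0 | move: P1 | move: P2];
  by congr P; apply: val_inj.
Qed.

Lemma vec3E {R : realType} (a b c : R) :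
  (vec3 a b c 0 0 = a) * (vec3 a b c 0 1 = b) * (vec3 a b c 0 2 = c).
Proof. by rewrite !mxE. Qed.

Lemma qformE {R : realType} (S : 'M[R]_3) (a b c : R) :
  qform S (vec3 a b c) =
    S 0 0 * a ^+ 2 + S 1 1 * b ^+ 2 + S 2 2 * c ^+ 2
    + (S 0 1 + S 1 0) * (a * b) + (S 0 2 + S 2 0) * (a * c)
    + (S 1 2 + S 2 1) * (b * c).
Proof.
by rewrite /qform !mxE big_ord3 !mxE !big_ord3 !vec3E /=; ring.
Qed.

Lemma qform_matA {R : realType} (a b c : R) :
  qform (matA R) (vec3 a b c) = a ^+ 2 + b ^+ 2 - c ^+ 2.
Proof. by rewrite qformE !mxE /= ?mulr1n ?mulr0n; ring. Qed.

Lemma det_mx33 {R : comNzRingType} (B : 'M[R]_3) :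
  \det B = B 0 0 * (B 1 1 * B 2 2 - B 1 2 * B 2 1)
    - B 0 1 * (B 1 0 * B 2 2 - B 1 2 * B 2 0)
    + B 0 2 * (B 1 0 * B 2 1 - B 1 1 * B 2 0).
Proof.
rewrite (expand_det_row _ 0) big_ord3 /cofactor.
rewrite !(expand_det_row _ 0) !big_ord_recl !big_ord0 /cofactor !det_mx11 !mxE.
(* Indexing by naturals identifies entries whose ordinals differ only in their bound proofs. *)
pose b (i j : nat) := B (inord i) (inord j).
have e i j : B i j = b i j by rewrite /b !inord_val.
move: b e => b e; rewrite !e /= /bump /=; ring.
Qed.

(** The vector [u] spans the [A]-orthogonal complement of the plane over [w], so it is a combination
    of [(Q, 1)] and [(n, 0)]. The conclusion says that the moments of [w] and [n] at [Q] are
    [A]-orthogonal. *)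
Lemma orthogonal_planes_matA {R : realType} (Q w n : 'rV[R]_2) :
  orthogonal_planes (matA R) (plane_over Q w) (plane_over Q n) ->
  crd1 w * crd1 n + crd2 w * crd2 n = Delta Q w * Delta Q n.
Proof.
pose u := vec3 (- crd2 w) (crd1 w) (- Delta Q w).
have uA a b c : u *m matA R *m (vec3 a b c)^T
    = (- crd2 w * a + crd1 w * b + Delta Q w * c)%:M.
  apply/matrixP => i j; rewrite !ord1 !mxE big_ord3 !mxE !big_ord3 !mxE /=.
  by rewrite /u; ring.
have uker : (u <= kermx (matA R *m (plane_over Q w)^T))%MS.
  rewrite sub_kermx mulmxA /plane_over tr_col_mx mul_mx_row !uA.
  rewrite /Delta; apply/eqP.
  have -> : - crd2 w * crd1 Q + crd1 w * crd2 Q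
      + (crd1 Q * crd2 w - crd2 Q * crd1 w) * 1 = 0 by ring.
  have -> : - crd2 w * crd1 w + crd1 w * crd2 w
      + (crd1 Q * crd2 w - crd2 Q * crd1 w) * 0 = 0 by ring.
  by rewrite raddf0 row_mx0.
rewrite /orthogonal_planes => kerP.
have /submxP[D uE] := submx_trans uker kerP.
rewrite /plane_over -[D]hsubmxK mul_row_col in uE.
rewrite (mx11_scalar (lsubmx D)) (mx11_scalar (rsubmx D)) in uE.
rewrite !mul_scalar_mx in uE.
move: (lsubmx D 0 0) (rsubmx D 0 0) uE => a b uE.
have e0 := congr1 (fun z : 'rV[R]_3 => z 0 0) uE.
have e1 := congr1 (fun z : 'rV[R]_3 => z 0 1) uE.
have e2 := congr1 (fun z : 'rV[R]_3 => z 0 2) uE.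
rewrite !mxE /= in e0 e1 e2.
have w1E : crd1 w = a * crd2 Q + b * crd2 n by [].
have w2E : crd2 w = - (a * crd1 Q + b * crd1 n) by rewrite -e0 opprK.
have DE : Delta Q w = - (a * 1 + b * 0) by rewrite -e2 opprK.
by rewrite DE w1E w2E /Delta; ring.
Qed.

(* The line through x directed by v is the covector [(- v2, v1, Delta)]; this
   is the quadratic form of the cofactor matrix of B evaluated on it. *)
Definition dual_conic {R : realType} (B : 'M[R]_3) : 'M[R]_3 :=
  \matrix_(i < 3, j < 3) (nth [::]
   [:: [:: B 0 0 * B 2 2 - B 0 2 ^+ 2; B 0 1 * B 2 2 - B 0 2 * B 1 2;
           B 0 1 * B 0 2 - B 0 0 * B 1 2];
       [:: B 0 1 * B 2 2 - B 0 2 * B 1 2; B 1 1 * B 2 2 - B 1 2 ^+ 2;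
           B 1 1 * B 0 2 - B 0 1 * B 1 2];
       [:: B 0 1 * B 0 2 - B 0 0 * B 1 2; B 1 1 * B 0 2 - B 0 1 * B 1 2;
           B 0 0 * B 1 1 - B 0 1 ^+ 2] ] i)`_j.

Lemma qform_dual_conic {R : realType} (B : 'M[R]_3) (v1 v2 D : R) :
  qform (dual_conic B) (vec3 v1 v2 D) =
    (B 0 0 * B 2 2 - B 0 2 ^+ 2) * v1 ^+ 2
    + (B 1 1 * B 2 2 - B 1 2 ^+ 2) * v2 ^+ 2
    + (B 0 0 * B 1 1 - B 0 1 ^+ 2) * D ^+ 2
    + 2 * (B 0 1 * B 2 2 - B 0 2 * B 1 2) * (v1 * v2)
    + 2 * (B 0 1 * B 0 2 - B 0 0 * B 1 2) * (v1 * D)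
    + 2 * (B 1 1 * B 0 2 - B 0 1 * B 1 2) * (v2 * D).
Proof. by rewrite qformE !mxE /=; ring. Qed.

(** Used for nonconstancy: a cofactor matrix proportional to [matA] determines [B] up to scale
    through [B adj(B) = det(B) I]. *)
Lemma dual_conic_proportional {R : realType} (B : 'M[R]_3) (k : R) :
  B^T = B -> B \in unitmx ->
  (forall v2 D, 1 + v2 ^+ 2 - D ^+ 2 != 0 ->
     qform (dual_conic B) (vec3 1 v2 D) = k * (1 + v2 ^+ 2 - D ^+ 2)) ->
  exists l : R, B = l *: matA R.
Proof.
move=> Bsym; rewrite unitmxE unitfE det_mx33 => det0 prop.
have b10 : B 1 0 = B 0 1 by rewrite -{1}Bsym mxE.
have b20 : B 2 0 = B 0 2 by rewrite -{1}Bsym mxE.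
have b21 : B 2 1 = B 1 2 by rewrite -{1}Bsym mxE.
have ev v2 D : 1 + v2 ^+ 2 - D ^+ 2 != 0 -> _ :=
  fun h => etrans (esym (qform_dual_conic B 1 v2 D)) (prop v2 D h).
(* Six points off the zero set of the form of [matA] determine the six coefficients. *)
have e00 := ev 0 0 ltac:(by rewrite lt0r_neq0 //; lra).
have e02 := ev 0 2 ltac:(by rewrite ltr0_neq0 //; lra).
have e02' := ev 0 (-2) ltac:(by rewrite ltr0_neq0 //; lra).
have e10 := ev 1 0 ltac:(by rewrite lt0r_neq0 //; lra).
have e10' := ev (-1) 0 ltac:(by rewrite lt0r_neq0 //; lra).
have e12 := ev 1 2 ltac:(by rewrite ltr0_neq0 //; lra).
rewrite b10 b20 b21 in det0.
have c11 : B 0 0 * B 2 2 - B 0 2 ^+ 2 = k by lra.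
have c22 : B 1 1 * B 2 2 - B 1 2 ^+ 2 = k by lra.
have c33 : B 0 0 * B 1 1 - B 0 1 ^+ 2 = - k by lra.
have c12 : B 0 1 * B 2 2 - B 0 2 * B 1 2 = 0 by lra.
have c13 : B 0 1 * B 0 2 - B 0 0 * B 1 2 = 0 by lra.
have c23 : B 1 1 * B 0 2 - B 0 1 * B 1 2 = 0 by lra.
set d := (X in X != 0) in det0.
have pk : B 0 0 * k = d.
  rewrite -c22 -[LHS]subr0 -(mulr0 (B 0 1)) -c12.
  by rewrite -[LHS]subr0 -(mulr0 (B 0 2)) -c23 /d;
    ring.
have k0 : k != 0 by apply: contra_neq det0 => k0; rewrite -pk k0 mulr0.
(* Entries of [B adj(B) = det(B) I], solved for one entry of [B] times a diagonal cofactor. *)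
have qk : B 0 1 * (B 1 1 * B 2 2 - B 1 2 ^+ 2)
    = B 1 1 * (B 0 1 * B 2 2 - B 0 2 * B 1 2)
      + B 1 2 * (B 1 1 * B 0 2 - B 0 1 * B 1 2)
  by ring.
have rk : B 0 2 * (B 1 1 * B 2 2 - B 1 2 ^+ 2)
    = B 1 2 * (B 0 1 * B 2 2 - B 0 2 * B 1 2)
      + B 2 2 * (B 1 1 * B 0 2 - B 0 1 * B 1 2)
  by ring.
have tk : B 1 2 * (B 0 0 * B 2 2 - B 0 2 ^+ 2)
    = B 0 2 * (B 0 1 * B 2 2 - B 0 2 * B 1 2)
      - B 2 2 * (B 0 1 * B 0 2 - B 0 0 * B 1 2)
  by ring.
have sk : B 1 1 * (B 0 0 * B 2 2 - B 0 2 ^+ 2)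
    = d + B 0 1 * (B 0 1 * B 2 2 - B 0 2 * B 1 2)
      - B 1 2 * (B 0 1 * B 0 2 - B 0 0 * B 1 2)
  by rewrite /d; ring.
have uk : B 2 2 * (B 0 0 * B 1 1 - B 0 1 ^+ 2)
    = d + B 0 2 * (B 1 1 * B 0 2 - B 0 1 * B 1 2)
      - B 1 2 * (B 0 1 * B 0 2 - B 0 0 * B 1 2)
  by rewrite /d; ring.
rewrite ?c11 ?c22 ?c33 ?c12 ?c13 ?c23 !mulr0 ?subr0 ?addr0 in qk rk tk sk uk.
have q0 : B 0 1 = 0 by apply: (mulIf k0); rewrite mul0r.
have r0 : B 0 2 = 0 by apply: (mulIf k0); rewrite mul0r.
have t0 : B 1 2 = 0 by apply: (mulIf k0); rewrite mul0r.
have s0 : B 1 1 = B 0 0 by apply: (mulIf k0); rewrite pk.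
have u0 : B 2 2 = - B 0 0.
  by apply: (mulIf k0); rewrite mulNr pk -uk mulrN opprK.
exists (B 0 0); apply/matrixP.
by apply: ord3P; apply: ord3P; rewrite !mxE /= ?mulr1n ?mulr0n ?b10 ?b20 ?b21
  ?q0 ?r0 ?t0 ?s0 ?u0; ring.
Qed.

(** The conic is parametrized by the pencil of lines through [Q]. The pair [(g1, g2)] is half the
    gradient of its equation at [Q]. *)
Lemma tangent_conic {R : realType} (B : 'M[R]_3) (F : set 'rV[R]_2)
    (Q : 'rV[R]_2)
    (g1 := B 0 0 * crd1 Q + B 0 1 * crd2 Q + B 0 2)
    (g2 := B 0 1 * crd1 Q + B 1 1 * crd2 Q + B 1 2) :
  B^T = B -> B \in unitmx -> finite_set F -> punctured_conic B F Q ->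
  vec2 (- g2) g1 != 0 /\
  tangent_vector (punctured_conic B F) Q (vec2 (- g2) g1).
Proof.
move=> Bsym; rewrite unitmxE unitfE det_mx33 => det0 finF [/= qQ nFQ].
have b10 : B 1 0 = B 0 1 by rewrite -{1}Bsym mxE.
have b20 : B 2 0 = B 0 2 by rewrite -{1}Bsym mxE.
have b21 : B 2 1 = B 1 2 by rewrite -{1}Bsym mxE.
have qE x : qform B (vec3 (crd1 x) (crd2 x) 1) = B 0 0 * crd1 x ^+ 2
    + 2 * B 0 1 * crd1 x * crd2 x + B 1 1 * crd2 x ^+ 2
    + 2 * B 0 2 * crd1 x + 2 * B 1 2 * crd2 x + B 2 2.
  by rewrite qformE b10 b20 b21; ring.
rewrite b10 b20 b21 in det0.
pose quad (x y : R) := B 0 0 * x ^+ 2 + 2 * B 0 1 * x * y + B 1 1 * y ^+ 2.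
(* On the conic [quad (- g2) g1 = - det B], so the tangent line is not contained in the conic. *)
have quadw : quad (- g2) g1 != 0.
  apply: contra_neq det0 => quad0; rewrite qE in qQ.
  suff : quad (- g2) g1 = (B 0 0 * B 1 1 - B 0 1 ^+ 2) * (B 0 0 * crd1 Q ^+ 2
    + 2 * B 0 1 * crd1 Q * crd2 Q + B 1 1 * crd2 Q ^+ 2
    + 2 * B 0 2 * crd1 Q + 2 * B 1 2 * crd2 Q + B 2 2) -
      (B 0 0 * (B 1 1 * B 2 2 - B 1 2 * B 1 2)
       - B 0 1 * (B 0 1 * B 2 2 - B 1 2 * B 0 2)
       + B 0 2 * (B 0 1 * B 1 2 - B 1 1 * B 0 2)).
    by rewrite quad0 qQ mulr0 sub0r => /esym/eqP; rewrite oppr_eq0 => /eqP.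
  by rewrite /quad /g1 /g2; ring.
pose G := g1 ^+ 2 + g2 ^+ 2.
have G0 : G != 0.
  apply: contra_neq quadw => /eqP; rewrite paddr_eq0 ?sqr_ge0 // !sqrf_eq0.
  by case/andP=> /eqP e1 /eqP e2; rewrite /quad e1 e2; ring.
split.
  apply: contra_neq quadw => /[dup] /(congr1 (@crd1 R)) + /(congr1 (@crd2 R)).
  by rewrite !crdE /crd1 /crd2 !mxE => -> ->; rewrite /quad; ring.
(* Along the direction [(- g2, g1) + t (g1, g2)] the equation becomes
   [s * (2 * t * G + s * u t) = 0]; [s t] is its second root, equal to [0] at [t = 0]. *)
pose u t := quad (- g2 + t * g1) (g1 + t * g2).
pose s t : R := - (2 * t * G) / u t.
pose g t : 'rV[R]_2 := Q + s t *: vec2 (- g2) g1 + (t * s t) *: vec2 g1 g2.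
have g0 : g 0 = Q by rewrite /g /s mulr0 mul0r oppr0 !mul0r !scale0r !addr0.
have ds : is_derive (0 : R) 1 s (- (2 * G) / quad (- g2) g1).
  have du : derivable (fun t => (u t)^-1) (0 : R) 1.
    apply: derivableV; first by rewrite /u !mul0r !addr0.
    pose p := (quad (- g2) g1)%:P + (2 * (B 0 0 * - g2 * g1
      + B 0 1 * (g1 * g1 - g2 * g2) + B 1 1 * g1 * g2))%:P * 'X
      + (quad g1 g2)%:P * 'X ^+ 2.
    have -> : u = horner p.
      by apply/funext => t; rewrite /p !hornerE /u /quad /=; ring.
    exact: derivable_horner.
  have dl : is_derive (0 : R) 1 (fun t => - (2 * G) * t) (- (2 * G)).
    have := @is_deriveZ R R R id (- (2 * G)) 0 1 1 (is_derive_id _ _).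
    by rewrite [_ *: 1]mulr1.
  have -> : s = (fun t => - (2 * G) * t) * (fun t => (u t)^-1).
    by apply/funext => t; rewrite /s -[RHS]/(- (2 * G) * t * (u t)^-1); ring.
  have := is_deriveM dl (derivableP du).
  rewrite mulr0 scale0r add0r /u !mul0r !addr0.
  by rewrite [X in is_derive _ _ _ X -> _]mulrC.
have dts : is_derive (0 : R) 1 (fun t => t * s t) 0.
  have := is_deriveM (is_derive_id (0 : R) 1) ds.
  have s0 : s 0 = 0 by rewrite /s mulr0 mul0r oppr0 mul0r.
  by rewrite scale0r add0r s0 scale0r.
have dg := is_derive_moving_combination Q (vec2 (- g2) g1) (vec2 g1 g2)
  _ _ _ _ ds dts.
rewrite scale0r addr0 in dg.
have c0 : - (2 * G) / quad (- g2) g1 != 0.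
  by rewrite mulf_neq0 ?invr_eq0 // oppr_eq0 mulf_neq0 // pnatr_eq0.
rewrite -[vec2 (- g2) g1]scale1r -(mulVf c0) -scalerA.
apply: tangent_vectorZ; exists g; split => //.
have nF0 : ~ F (g 0) by rewrite g0.
apply: filterS (finite_set_avoided _ _ _ finF nF0 dg) => t nFt; split => //=.
rewrite qE /g !crdE; rewrite qE in qQ.
(* Where [u t = 0], division by zero gives [s t = 0], and the point is [Q] itself. *)
have su : s t * (2 * t * G + s t * u t) = 0.
  rewrite /s; have [->|u0] := eqVneq (u t) 0.
    by rewrite invr0 mulr0 mul0r.
  by rewrite divfK // addrN mulr0.
rewrite -[RHS]su -[RHS]add0r -qQ /u /quad /G /g1 /g2; ring.
Qed.

(** As [matA] is its own inverse and its form is unchanged by a quarter turn of [(v1, v2)], it is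
    its own dual in the moments. *)
Lemma integral_space_form {R : realType} (B : 'M[R]_3) (F : set 'rV[R]_2)
    (N : 'rV[R]_2 -> 'rV[R]_2) :
  B^T = B -> B \in unitmx -> (forall k : R, B <> k *: matA R) ->
  finite_set F ->
  transversal_field (punctured_conic B F) N ->
  space_form_field (matA R) (punctured_conic B F) N ->
  rational_0homogeneous_integral (punctured_conic B F) N
    (in_moments (fun v1 v2 D => qform (dual_conic B) (vec3 v1 v2 D)))
    (in_moments (fun v1 v2 D => qform (matA R) (vec3 v1 v2 D))).
Proof.
move=> Bsym Bu BA finF trN sfN.
have b10 : B 1 0 = B 0 1 by rewrite -{1}Bsym mxE.
have b20 : B 2 0 = B 0 2 by rewrite -{1}Bsym mxE.
have b21 : B 2 1 = B 1 2 by rewrite -{1}Bsym mxE.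
have qhom (S : 'M[R]_3) x : homogeneous_poly 2
    (in_moments (fun v1 v2 D => qform S (vec3 v1 v2 D)) x).
  apply: (homogeneous_poly_ext _ (fun v =>
    S 0 0 * crd1 v ^+ 2 + S 1 1 * crd2 v ^+ 2 + S 2 2 * Delta x v ^+ 2
    + (S 0 1 + S 1 0) * (crd1 v * crd2 v)
    + (S 0 2 + S 2 0) * (crd1 v * Delta x v)
    + (S 1 2 + S 2 1) * (crd2 v * Delta x v))).
    by move=> v; rewrite /in_moments qformE.
  by homogeneous.
have den0 (x : 'rV[R]_2) :
    exists v,
      in_moments (fun v1 v2 D => qform (matA R) (vec3 v1 v2 D)) x v != 0.
  rewrite /in_moments; under eq_exists do rewrite qform_matA.
  (* The velocities [(1, 0)], [(0, 1)], [(1, 1)] are tried in turn: when the first two fail,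
     [x1 ^+ 2 = x2 ^+ 2 = 1] and the third gives [2 * x1 * x2]. *)
  have [x2|x2] := eqVneq (crd2 x ^+ 2) 1; last first.
    exists (vec2 1 0); rewrite /Delta !crdE; apply: contra_neq x2; lra.
  have [x1|x1] := eqVneq (crd1 x ^+ 2) 1; last first.
    exists (vec2 0 1); rewrite /Delta !crdE; apply: contra_neq x1; lra.
  have [x12|x12] := eqVneq (crd1 x * crd2 x) 0.
    exfalso; have : (crd1 x * crd2 x) ^+ 2 = 1 by rewrite exprMn x1 x2 mulr1.
    by rewrite x12 expr0n /= => /esym/eqP; rewrite oner_eq0.
  exists (vec2 1 1); rewrite /Delta !crdE !mulr1.
  by apply: contra_neq x12; lra.
split.
- split; first by exists 2%N.
  + by move=> x; have [v dv] := den0 x; exists v; right.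
  + apply: (dense_affine_neq0 0 0 1); first by rewrite oner_eq0 !orbT.
    by move=> x _; exact: den0.
- apply: contrapT => const.
  suff [l /BA //] : exists l : R, B = l *: matA R.
  (* A constant ratio must equal its value at the moments [(1, 0, 0)], where the denominator is
     [1]. *)
  apply: (dual_conic_proportional B (qform (dual_conic B) (vec3 1 0 0))) => //.
  move=> v2 D dv; apply: contrapT => /eqP neq; apply: const.
  apply: (nonconstant_in_moments _ _ 1 v2 D 1 0 0);
    rewrite ?oner_eq0 ?qform_matA ?expr1n ?expr0n ?addr0 ?subr0 ?oner_eq0 //=.
  by rewrite divr1; apply: contra_neq neq => <-; rewrite divfK.
- apply: (first_integral_in_moments _ _ _ _ trN) => Q CQ.
  have [w0 tw] := tangent_conic B F Q Bsym Bu finF CQ.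
  eexists; split; [exact: tw | exact: w0 | move=> a b].
  have := orthogonal_planes_matA Q _ _ (sfN Q _ CQ tw w0).
  rewrite /in_moments !qform_matA !qform_dual_conic /Delta !crdE.
  case: CQ => /= + _; rewrite qformE b10 b20 b21.
  move: (N Q) => n; set q := (X in X = 0) => qQ orth; split; last first.
    by have := congr1 (fun z => 4 * a * b * z) orth; lra.
  apply/eqP; rewrite -subr_eq0; apply/eqP.
  (* The cross term of the dual form is a multiple of the equation [q] of the conic at [Q]. *)
  transitivity (- 4 * a * b *
    ((B 1 1 * B 0 2 - B 0 1 * B 1 2) * crd2 n
     + (B 0 1 * B 0 2 - B 0 0 * B 1 2) * crd1 n
     + (B 0 0 * B 1 1 - B 0 1 ^+ 2)
       * (crd1 Q * crd2 n - crd2 Q * crd1 n)) * q).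
    by rewrite /q; ring.
  by rewrite qQ mulr0.
Qed.

Theorem mainTheorem8 (R : realType) :
  (* Case 1 *)
  (forall (B : 'M[R]_3) (F : set 'rV[R]_2) (N : 'rV[R]_2 -> 'rV[R]_2),
     B^T = B -> B \in unitmx -> (forall k : R, B <> k *: matA R) ->
     finite_set F ->
     transversal_field (punctured_conic B F) N ->
     space_form_field (matA R) (punctured_conic B F) N ->
     exists S T : 'M[R]_3,
       rational_0homogeneous_integral (punctured_conic B F) N
         (in_moments (fun v1 v2 D => qform S (vec3 v1 v2 D)))
         (in_moments (fun v1 v2 D => qform T (vec3 v1 v2 D))))
  /\
  (* Cases 2 *)
  (forall (F : set 'rV[R]_2), finite_set F ->
   let C := punctured_parabola F in
   [/\
     (* 2a1 *)
     forall n : nat, (0 < n)%N ->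
       let rho : R := 2 - 2 / (2 * n%:R + 1) in
       let c := fun j : nat =>
         - (4 * j%:R * (2 * n%:R + 1 - j%:R))
           / (2 * n%:R + 1 - 2 * j%:R) ^+ 2 : R in
       let N := fun x => vec2 rho (2 * (rho - 2) * crd1 x) in
       transversal_field C N ->
       rational_0homogeneous_integral C N
         (in_moments (fun v1 v2 D => (4 * v1 * D - v2 ^+ 2) ^+ (2 * n + 1)))
         (in_moments (fun v1 v2 D =>
            v1 ^+ 2 *
            \prod_(1 <= j < n.+1) (4 * v1 * D - c j * v2 ^+ 2) ^+ 2)),
     (* 2a2 *)
     forall n : nat, (0 < n)%N ->
       let rho : R := 2 - 1 / (n%:R + 1) in
       let c := fun j : nat =>
         - (j%:R * (2 * n%:R + 2 - j%:R)) / (n%:R + 1 - j%:R) ^+ 2 : R in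
       let N := fun x => vec2 rho (2 * (rho - 2) * crd1 x) in
       transversal_field C N ->
       rational_0homogeneous_integral C N
         (in_moments (fun v1 v2 D => (4 * v1 * D - v2 ^+ 2) ^+ (n + 1)))
         (in_moments (fun v1 v2 D =>
            v1 * v2 * \prod_(1 <= j < n.+1) (4 * v1 * D - c j * v2 ^+ 2))),
     (* 2b1 and 2b2 *)
     (let N := fun x => vec2 (5 * crd1 x + 3) (2 * (crd2 x - crd1 x)) in
      transversal_field C N ->
      rational_0homogeneous_integral C N
        (in_moments (fun v1 v2 D => (4 * v1 * D - v2 ^+ 2) ^+ 2))
        (in_moments (fun v1 v2 D =>
           (4 * v1 * D + 3 * v2 ^+ 2) * (2 * v1 + v2) * (2 * D + v2))))
     /\
     (let N := fun x => vec2 (3 * crd1 x) (2 * crd2 x - 4) in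
      transversal_field C N ->
      rational_0homogeneous_integral C N
        (in_moments (fun v1 v2 D => (4 * v1 * D - v2 ^+ 2) ^+ 2))
        (in_moments (fun v1 v2 D =>
           (v2 ^+ 2 + 4 * D ^+ 2 + 4 * v1 * D + 4 * v1 ^+ 2)
           * (v2 ^+ 2 + 4 * v1 ^+ 2)))),
     (* 2c1 and 2c2 *)
     (let N := fun x => vec2 (crd2 x) (crd1 x * crd2 x - 1) in
      transversal_field C N ->
      rational_0homogeneous_integral C N
        (in_moments (fun v1 v2 D => (4 * v1 * D - v2 ^+ 2) ^+ 3))
        (in_moments (fun v1 v2 D =>
           (v1 ^+ 3 + D ^+ 3 + v1 * v2 * D) ^+ 2)))
     /\
     (let N := fun x => vec2 (2 * crd1 x + 1) (crd2 x - crd1 x) in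
      transversal_field C N ->
      rational_0homogeneous_integral C N
        (in_moments (fun v1 v2 D => (4 * v1 * D - v2 ^+ 2) ^+ 3))
        (in_moments (fun v1 v2 D =>
           (v2 ^+ 3 + 2 * v2 ^+ 2 * v1
            + (v1 ^+ 2 + 2 * v2 ^+ 2 + 5 * v1 * v2) * D
            + v1 * D ^+ 2) ^+ 2)))
   & (* 2d *)
     let N := fun x => vec2 (7 * crd1 x + 4) (2 * crd2 x - 4 * crd1 x) in
     transversal_field C N ->
     rational_0homogeneous_integral C N
       (in_moments (fun v1 v2 D => (4 * v1 * D - v2 ^+ 2) ^+ 3))
       (in_moments (fun v1 v2 D =>
          (v1 * D + 2 * v2 ^+ 2) * (2 * v1 + v2)
          * (8 * v1 * v2 ^+ 2 + 2 * v2 ^+ 3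
             + (4 * v1 ^+ 2 + 5 * v2 ^+ 2 + 28 * v1 * v2) * D
             + 16 * v1 * D ^+ 2)))]).
Proof.
split=> [B F N Bsym Bu BA finF trN sfN|F finF C].
  by exists (dual_conic B), (matA R); exact: integral_space_form.
split.
- exact (fun n _ => integral_2a1 F n finF).
- exact (fun n _ => integral_2a2 F n finF).
- exact (conj (integral_2b1 F finF) (integral_2b2 F finF)).
- exact (conj (integral_2c1 F finF) (integral_2c2 F finF)).
- exact (integral_2d F finF).
Qed.
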